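(* Let $A$ be a proper unital $*$-ring such that $A_\Sigma\cap-A_\Sigma=\{0\}$. Then, with all relations restricted to the subset $\tfrac12\mathfrak{F}$ of $A$, the relation $\ll$ is auxiliary to each of the relations $\preceq^{\mathfrak{r}}$, $\preceq^{\mathfrak{c}}$, $\preceq^{\mathfrak{B}}$, $\preceq^{\mathfrak{F}}$ and $\preceq^*$.
   Context: A $*$-ring is an associative ring with a map $a\mapsto a^*$ satisfying $a^{**}=a$, $(ab)^*=b^*a^*$, $(a+b)^*=a^*+b^*$; it is proper if $a^*a=0$ implies $a=0$. Unital means having a two-sided unit $1$. $A_\Sigma$ is the set of all finite sums $\sum_{k=1}^n a_k^*a_k$ with $n\geq1$, $a_k\in A$. $A_+=\{a\in A:na\in A_\Sigma\text{ for some positive integer }n\}$. $\mathfrak{r}=\{a\in A:a+a^*\in A_+\}$. Relations on $A$: $a\preceq^{\mathfrak{r}}b\Leftrightarrow b-a\in\mathfrak{r}$. Using it define $\mathfrak{B}=\{a:a^*a\preceq^{\mathfrak{r}}1\}$, $\tfrac12\mathfrak{F}=\{a:a^*a\preceq^{\mathfrak{r}}a\}$, $\mathfrak{F}=\{a:a^*a\preceq^{\mathfrak{r}}2a\}$, $\mathfrak{c}=\{a:a^*a\preceq^{\mathfrak{r}}na\text{ for some positive integer }n\}$. Then $a\ll b\Leftrightarrow a=ab$; $a\preceq^{\mathfrak{c}}b\Leftrightarrow b-a\in\mathfrak{c}$; $a\preceq^{\mathfrak{B}}b\Leftrightarrow a=cb$ for some $c\in\mathfrak{B}$; $a\preceq^{\mathfrak{F}}b\Leftrightarrow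 b=a+f-af$ for some $f\in\mathfrak{F}$; $a\preceq^*b\Leftrightarrow a^*a\preceq^{\mathfrak{r}}b^*b$. For relations $\ll,\preceq$ on a set $X$, the composition is $a\mathbin{(\ll\circ\preceq)}b\Leftrightarrow\exists c\in X\ (a\ll c\preceq b)$. The relation $\ll$ is auxiliary to $\preceq$ (on $X$) if $(\ll\circ\preceq)=(\ll)$, $(\preceq\circ\ll)=(\ll)$ and $(\ll)\subseteq(\preceq)$, as relations on $X$; here $X=\tfrac12\mathfrak{F}$. *)

(* Defs.v *)
From HB Require Import structures.
From mathcomp Require Import all_boot ssralg.
From mathcomp Require Import classical_sets.

Set Implicit Arguments.
Unset Strict Implicit.
Unset Printing Implicit Defensive.

Import GRing.Theory.
Local Open Scope ring_scope.
Local Open Scope classical_set_scope.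

(* A unital *-ring. The base structure is [pzRingType], so the zero ring is
   allowed; [star 1 = 1] is a consequence of the axioms. *)
HB.mixin Record PzRing_hasStar A of GRing.PzRing A := {
  star : A -> A;
  starK : forall a, star (star a) = a;
  starM : forall a b, star (a * b) = star b * star a;
  starD : forall a b, star (a + b) = star a + star b
}.

#[short(type="starRingType")]
HB.structure Definition StarRing := {A of PzRing_hasStar A & GRing.PzRing A}.

Definition proper_star (A : starRingType) : Prop :=
  forall a : A, star a * a = 0 -> a = 0.

Section Subsets.
Variable A : starRingType.
Implicit Types a b : A.

Definition Sigma : set A :=
  [set s | exists (n : nat) (a : 'I_n -> A),
     (0 < n)%N /\ s = \sum_(k < n) star (a k) * a k].

Definition Aplus : set A := [set a | exists2 n : nat, (0 < n)%N & Sigma (a *+ n)].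

Definition frakr : set A := [set a | Aplus (a + star a)].

Definition le_r a b : Prop := frakr (b - a).

Definition frakB : set A := [set a | le_r (star a * a) 1].

Definition half_frakF : set A := [set a | le_r (star a * a) a].

Definition frakF : set A := [set a | le_r (star a * a) (a *+ 2)].

Definition frakc : set A :=
  [set a | exists2 n : nat, (0 < n)%N & le_r (star a * a) (a *+ n)].

Definition ll a b : Prop := a = a * b.

Definition le_c a b : Prop := frakc (b - a).

Definition le_B a b : Prop := exists2 c, frakB c & a = c * b.

Definition le_F a b : Prop := exists2 f, frakF f & b = a + f - a * f.

Definition le_star a b : Prop := le_r (star a * a) (star b * b).

End Subsets.

Arguments Sigma {A}.
Arguments Aplus {A}.
Arguments frakr {A}.
Arguments frakB {A}.
Arguments half_frakF {A}.
Arguments frakF {A}.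
Arguments frakc {A}.

(* Composition of relations restricted to [X]: the intermediate point must
   itself lie in [X]. *)
Definition comp_on (T : Type) (X : set T) (R S : T -> T -> Prop) (a b : T) :
  Prop := exists c, [/\ X c, R a c & S c b].

Definition auxiliary_on (T : Type) (X : set T) (R S : T -> T -> Prop) : Prop :=
  [/\ forall a b, X a -> X b -> (comp_on X R S a b <-> R a b),
      forall a b, X a -> X b -> (comp_on X S R a b <-> R a b)
    & forall a b, X a -> X b -> R a b -> S a b].

(* Main.v *)
Require Import Defs.
From mathcomp Require Import all_boot ssralg.
From mathcomp Require Import classical_sets.

Set Implicit Arguments.
Unset Strict Implicit.
Unset Printing Implicit Defensive.

Import GRing.Theory.
Local Open Scope ring_scope.
Local Open Scope classical_set_scope.

(** The set [frakr] is a cone, stable under [z |-> x^* z x] and containing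
    every skew element [y - y^*], so [le_r] is a translation-invariant
    preorder for which [a] and [a^*] are interchangeable. Properness and the
    hypothesis on sums of squares enter only through [norm_le0_eq0]: [z^* z]
    below [0] forces [z = 0]. On [half_frakF], where [x^* x] is below [x],
    this improves to [half_frakF_ann]: [y^* x y] below [0] forces [x y = 0].
    As [half_frakF] is stable under [x |-> x^*] and [x |-> 1 - x], absorption
    for [le_r] and [le_star] reduces to an inequality of this kind: [a << b]
    means [a (1 - b) = 0], which follows once [a (1 - b) a^*], or [(1 - b)^* a
    (1 - b)], is below [0], and compressing [c <= b] by [a], or [a <= c] by [1
    - b], produces such an inequality (for [le_star] and [a <= c], directly on
    the norm of [a (1 - b)]).

    The relations [le_c] and [le_B] are contained in [le_r] and [le_star]
    respectively, hence inherit absorption from them. For [le_F], the relation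
    [a <= b] says [1 - b = (1 - a) (1 - f)] with [1 - f] a contraction: then
    [1 - b] is annihilated on the left by everything that so annihilates [1 -
    a], and the other absorption is again an inequality obtained by
    compression. The inclusion of [<<] in [le_r] and [le_c] comes from
    [half_frakF_sub]: if [a << b] then [b - a] is again in [half_frakF]. For
    [le_B] and [le_F] the elements witnessing the inclusion are [a] and [b]
    themselves. *)

(** * Criteria for auxiliarity *)

(** Reflexivity of [S] gives the two inclusions of [R] in the
    compositions, so that auxiliarity is a matter of absorption and inclusion. *)
Lemma auxiliary_onI (T : Type) (X : set T) (R S : T -> T -> Prop) :
    (forall a, S a a) ->
    (forall a b, X a -> X b -> R a b -> S a b) ->
    (forall a c b, X a -> X c -> X b -> R a c -> S c b -> R a b) ->
    (forall a c b, X a -> X c -> X b -> S a c -> R c b -> R a b) ->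
  auxiliary_on X R S.
Proof.
move=> Srefl RS absr absl; split=> // a b Xa Xb; split.
- by move=> [c [Xc Rac Scb]]; exact: absr Rac Scb.
- by move=> Rab; exists b.
- by move=> [c [Xc Sac Rcb]]; exact: absl Sac Rcb.
- by move=> Rab; exists a.
Qed.

(** Absorption passes to any smaller relation [S'], while reflexivity and the
    inclusion of [R] have to be established anew. *)
Lemma auxiliary_on_sub (T : Type) (X : set T) (R S S' : T -> T -> Prop) :
    auxiliary_on X R S -> (forall a b, S' a b -> S a b) -> (forall a, S' a a) ->
    (forall a b, X a -> X b -> R a b -> S' a b) ->
  auxiliary_on X R S'.
Proof.
move=> [absr absl _] S'S S'refl RS'; apply: auxiliary_onI => // a c b Xa Xc Xb.
  by move=> Rac /S'S Scb; apply/absr => //; exists c.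
by move=> /S'S Sac Rcb; apply/absl => //; exists c.
Qed.

(** * Adjoints *)

Section StarRing.
Variable A : starRingType.
Implicit Types (a b c f x y z : A) (n : nat).

Local Notation "x ^*" := (star x).

Lemma star0 : (0 : A)^* = 0.
Proof. by apply: (@addrI _ (0 : A)^*); rewrite -starD !addr0. Qed.

Lemma starN x : (- x)^* = - x^*.
Proof. by apply: (@addrI _ x^*); rewrite -starD !subrr star0. Qed.

Lemma starB x y : (x - y)^* = x^* - y^*.
Proof. by rewrite starD starN. Qed.

Lemma star1 : (1 : A)^* = 1.
Proof. by rewrite -[LHS]mulr1 -{2}[1 in LHS]starK -starM mulr1 starK. Qed.

Lemma starMn x n : (x *+ n)^* = x^* *+ n.
Proof. by elim: n => [|n IH]; rewrite ?mulr0n ?star0 // !mulrS starD IH. Qed.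

(** * Positive elements *)

Lemma Sigma_norm z : Sigma (z^* * z).
Proof. by exists 1%N, (fun=> z); rewrite big_ord1. Qed.

Lemma Sigma_add x y : Sigma x -> Sigma y -> Sigma (x + y).
Proof.
move=> [m [f [m0 ->]]] [n [g [n0 ->]]].
exists (m + n)%N, (fun i => match split i with inl j => f j | inr k => g k end).
split; first by rewrite addn_gt0 m0.
rewrite big_split_ord; congr (_ + _); apply: eq_bigr => i _.
  by rewrite -[lshift _ _]/(unsplit (inl i)) unsplitK.
by rewrite -[rshift _ _]/(unsplit (inr i)) unsplitK.
Qed.

Lemma Sigma_conj x z : Sigma z -> Sigma (x^* * z * x).
Proof.
move=> [n [f [n0 ->]]]; exists n, (fun i => f i * x); split=> //.
by rewrite mulr_sumr mulr_suml; apply: eq_bigr => i _; rewrite starM !mulrA.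
Qed.

Lemma Sigma0 : Sigma (0 : A).
Proof. by have := Sigma_norm 0; rewrite mulr0. Qed.

Lemma Sigma_muln x n : Sigma x -> Sigma (x *+ n).
Proof.
move=> Sx; elim: n => [|n IH]; first exact: Sigma0.
by rewrite mulrS; exact: Sigma_add.
Qed.

Lemma Sigma_Aplus x : Sigma x -> Aplus x.
Proof. by exists 1%N. Qed.

Lemma Aplus_add x y : Aplus x -> Aplus y -> Aplus (x + y).
Proof.
move=> [m m0 Sx] [n n0 Sy]; exists (m * n)%N; first by rewrite muln_gt0 m0.
rewrite mulrnDl; apply: Sigma_add; first by rewrite mulrnA; exact: Sigma_muln.
by rewrite mulnC mulrnA; exact: Sigma_muln.
Qed.

Lemma Aplus_conj x z : Aplus z -> Aplus (x^* * z * x).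
Proof.
by move=> [n n0 Sz]; exists n => //; rewrite -mulrnAl -mulrnAr; exact: Sigma_conj.
Qed.

Lemma Aplus_muln n x : (0 < n)%N -> Aplus (x *+ n) <-> Aplus x.
Proof.
move=> n0; split=> [[m m0 S]|[m m0 S]].
  by exists (n * m)%N; rewrite ?muln_gt0 ?n0 // mulrnA.
by exists m; rewrite // -mulrnA mulnC mulrnA; exact: Sigma_muln.
Qed.

(** * The preorder of accretive differences *)

Lemma frakr_add x y : frakr x -> frakr y -> frakr (x + y).
Proof. by rewrite /frakr /= starD addrACA; exact: Aplus_add. Qed.

Lemma frakr_conj x z : frakr z -> frakr (x^* * z * x).
Proof.
rewrite /frakr /= => /(@Aplus_conj x).
by rewrite mulrDr mulrDl !starM starK mulrA.
Qed.

Lemma frakr_star z : frakr z -> frakr z^*.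
Proof. by rewrite /frakr /= starK addrC. Qed.

Lemma frakr_skew y : frakr (y - y^*).
Proof.
by rewrite /frakr /= starB starK addrA subrK subrr; exact/Sigma_Aplus/Sigma0.
Qed.

Lemma frakr0 : frakr (0 : A).
Proof. by have := frakr_skew 0; rewrite star0 subrr. Qed.

Lemma frakr_norm z : frakr (z^* * z).
Proof.
by rewrite /frakr /= starM starK; apply/Aplus_add; exact/Sigma_Aplus/Sigma_norm.
Qed.

Lemma frakr_muln n x : (0 < n)%N -> frakr (x *+ n) <-> frakr x.
Proof. by move=> n0; rewrite /frakr /= starMn -mulrnDl; exact: Aplus_muln. Qed.

Lemma le_r_refl x : le_r x x.
Proof. by rewrite /le_r subrr; exact: frakr0. Qed.

Lemma le_r_trans x y z : le_r x y -> le_r y z -> le_r x z.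
Proof. by rewrite /le_r => xy yz; rewrite -(subrK y z) -addrA; exact: frakr_add. Qed.

Lemma le_r_conj x y z : le_r y z -> le_r (x^* * y * x) (x^* * z * x).
Proof. by rewrite /le_r -mulrBl -mulrBr; exact: frakr_conj. Qed.

Lemma le_r_conjl x y z : le_r y z -> le_r (x * y * x^*) (x * z * x^*).
Proof. by move/(@le_r_conj x^*); rewrite starK. Qed.

(** * Contractions and the elements between 0 and 1 *)

(** With [p = b b^*], conjugating [b^* b <= 1] by [b^*] gives [p^2 <= p], and
    then [1 - p = (1 - p)^2 + (p - p^2)] is a sum of positive elements. *)
Lemma frakB_star b : frakB b -> frakB b^*.
Proof.
rewrite /frakB /= starK => /(@le_r_conjl b); rewrite mulr1.
set p := b * b^*; have -> : b * (b^* * b) * b^* = p * p by rewrite !mulrA.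
rewrite /le_r => Pp.
have p_sa : p^* = p by rewrite starM starK.
have -> : 1 - p = (1 - p)^* * (1 - p) + (p - p * p).
  by rewrite starB star1 p_sa mulrBr mulr1 mulrBl mul1r subrK.
by apply: frakr_add Pp; exact: frakr_norm.
Qed.

Lemma frakF_frakB f : frakF f <-> frakB (1 - f).
Proof.
rewrite /frakF /frakB /= /le_r.
have -> : 1 - (1 - f)^* * (1 - f) = f + f^* - f^* * f.
  by rewrite starB star1 mulrBr mulr1 mulrBl mul1r !opprB addrC !addrA subrK addrAC.
(* The two elements differ by the skew element [f - f^*]. *)
split=> H.
  have := frakr_add (frakr_skew f^*) H.
  by rewrite starK mulr2n !addrA subrK [f^* + f]addrC.
have := frakr_add (frakr_skew f) H.
by rewrite [f + f^*]addrC mulr2n !addrA subrK.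
Qed.

(** This change of variable turns the symmetry of contractions under the adjoint
    into that of [half_frakF]. *)
Lemma half_frakF_frakB a : half_frakF a <-> frakB (1 - a *+ 2).
Proof.
rewrite -frakF_frakB /frakF /half_frakF /= /le_r starMn mulrnAl mulrnAr.
by rewrite -!mulrnA -mulrnBl frakr_muln.
Qed.

Lemma half_frakF_star a : half_frakF a -> half_frakF a^*.
Proof.
move/half_frakF_frakB/frakB_star; rewrite starB star1 starMn.
by move/half_frakF_frakB.
Qed.

(** As [(1 - a)^* (1 - a)] falls short of [1 - a] by [a^* (1 - a)], the gap
    differs from [a - a^* a] only by the skew element [a^* - a]. *)
Lemma half_frakF_compl a : half_frakF a -> half_frakF (1 - a).
Proof.
rewrite /half_frakF /= /le_r => Fa.
have -> : 1 - a - (1 - a)^* * (1 - a) = (a^* - a^*^*) + (a - a^* * a).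
  rewrite -{1}[1 - a]mul1r -mulrBl starB star1 subKr mulrBr mulr1 starK.
  by rewrite addrA subrK.
by apply: frakr_add Fa; exact: frakr_skew.
Qed.

Lemma half_frakF_frakr a : half_frakF a -> frakr a.
Proof.
by move=> Fa; rewrite -(subrK (a^* * a) a); exact: frakr_add Fa (frakr_norm _).
Qed.

Lemma half_frakF_frakF a : half_frakF a -> frakF a.
Proof.
move=> Fa; rewrite /frakF /= /le_r mulr2n -addrA.
exact: frakr_add (half_frakF_frakr Fa) Fa.
Qed.

Lemma half_frakF_in_frakB a : half_frakF a -> frakB a.
Proof.
move=> Fa; apply: (le_r_trans Fa).
exact: half_frakF_frakr (half_frakF_compl Fa).
Qed.

Lemma frakB1 : frakB (1 : A).
Proof. by rewrite /frakB /= star1 mulr1; exact: le_r_refl. Qed.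

Lemma frakF0 : frakF (0 : A).
Proof. by apply/frakF_frakB; rewrite subr0; exact: frakB1. Qed.

(** * Inclusions between the relations *)

(** [n (b - a)] exceeds a norm, and positivity does not see the factor [n]. *)
Lemma le_c_le_r a b : le_c a b -> le_r a b.
Proof.
move=> [n n0 H]; apply: (proj1 (frakr_muln _ n0)).
by rewrite -(subrK ((b - a)^* * (b - a)) (_ *+ n)); exact: frakr_add H (frakr_norm _).
Qed.

Lemma le_B_le_star a b : le_B a b -> le_star a b.
Proof.
move=> [c /(@le_r_conj b) Bc ->]; move: Bc.
by rewrite /le_star starM mulr1 !mulrA.
Qed.

Lemma llP a b : ll a b <-> a * (1 - b) = 0.
Proof.
rewrite /ll mulrBr mulr1; split=> [<-|/eqP]; first by rewrite subrr.
by rewrite subr_eq0 => /eqP.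
Qed.

(** The relation says that [1 - b] factors through [1 - a], which makes it dual
    to [le_B] under [x |-> (1 - x)^*]. *)
Lemma le_F_compl a b f : b = a + f - a * f -> 1 - b = (1 - a) * (1 - f).
Proof.
move=> ->; rewrite mulrBr mulr1 mulrBl mul1r !opprD !opprK !addrA.
by congr (_ + _).
Qed.

End StarRing.

(** * Annihilation and the domination relation *)

Section Annihilation.
Variable A : starRingType.
Hypothesis properA : proper_star A.
Hypothesis SigmaA :
  (Sigma : set A) `&` [set - s | s in (Sigma : set A)] = [set 0].
Implicit Types a b c x y z : A.

Local Notation "x ^*" := (star x).

(** If [- k z^* z] is a sum of squares for some [k > 0], adding [k - 1] copies of
    [z^* z] shows that [- z^* z] is one as well. *)
Lemma norm_le0_eq0 z : le_r (z^* * z) 0 -> z = 0.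
Proof.
rewrite /le_r sub0r /frakr /= starN starM starK -mulr2n => Hz.
have {Hz} [[//|k] _ Sk] := proj1 (Aplus_muln _ (isT : (0 < 2)%N)) Hz.
have Sz := Sigma_norm z.
apply: properA.
suff : ((Sigma : set A) `&` [set - s | s in (Sigma : set A)]) (z^* * z).
  by rewrite SigmaA.
split=> //; exists (- (z^* * z)); last by rewrite opprK.
have := Sigma_add Sk (Sigma_muln k Sz).
by rewrite mulrS mulNrn subrK.
Qed.

(** Since [x^* x] is below [x], the norm [(x y)^* (x y)] is below [y^* x y]. *)
Lemma half_frakF_ann x y : half_frakF x -> le_r (y^* * x * y) 0 -> x * y = 0.
Proof.
move=> /(le_r_conj y) Fx /(le_r_trans Fx) H.
by apply: norm_le0_eq0; rewrite starM -mulrA (mulrA x^*) mulrA.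
Qed.

Lemma half_frakF_annl x y : half_frakF x -> le_r (y * x * y^*) 0 -> y * x = 0.
Proof.
move=> /half_frakF_star Fx H; rewrite -[y * x]starK starM.
rewrite half_frakF_ann ?star0 // starK.
move: H => /frakr_star.
by rewrite /le_r !sub0r starN !starM starK mulrA.
Qed.

(** If [x y = 0], then [y^* x y = 0], and so its adjoint [y^* x^* y] is [0]. *)
Lemma half_frakF_ann_star x y : half_frakF x -> x * y = 0 -> x^* * y = 0.
Proof.
move=> /half_frakF_star Fx xy0; apply: half_frakF_ann => //.
by rewrite -starM xy0 star0 mul0r; exact: le_r_refl.
Qed.

(** This is [half_frakF_ann_star] for [x = (1 - b)^*] and [y = a^*]. *)
Lemma ll_star a b : half_frakF b -> ll a b -> ll a b^*.
Proof.
move=> Fb /llP ab; apply/llP.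
have ba0 : (1 - b)^* * a^* = 0 by rewrite -starM ab star0.
have := half_frakF_ann_star (half_frakF_star (half_frakF_compl Fb)) ba0.
by move/(congr1 star); rewrite starM !starK star0 starB star1.
Qed.

Lemma ll_of_le a b : half_frakF b -> le_r (a * a^*) (a * b * a^*) -> ll a b.
Proof.
move=> Fb H; apply/llP/half_frakF_annl; first exact: half_frakF_compl.
by move: H; rewrite /le_r sub0r mulrBr mulr1 mulrBl opprB.
Qed.

Lemma ll_of_le0 a b :
  half_frakF a -> le_r ((1 - b)^* * a * (1 - b)) 0 -> ll a b.
Proof. by move=> Fa H; apply/llP/half_frakF_ann. Qed.

(** As [a b = a b^* = a], the product [(b - a) (b - a)^*] is
    [b b^* - a - a^* + a a^*], so that [(b - a)^*] exceeds it by the sum of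
    [b^* - b b^*] and [a - a a^*], both of which lie in [frakr]. *)
Lemma half_frakF_sub a b :
  half_frakF a -> half_frakF b -> ll a b -> half_frakF (b - a).
Proof.
move=> Fa Fb ab; rewrite -[b - a]starK; apply: half_frakF_star.
have abs : a * b^* = a by rewrite -(ll_star Fb ab).
have bas : b * a^* = a^* by rewrite -{2}abs starM starK.
rewrite /half_frakF /= /le_r starK.
have -> : (b - a)^* - (b - a) * (b - a)^* = (b^* - b * b^*) + (a - a * a^*).
  rewrite starB mulrBr !mulrBl abs bas !opprB.
  by rewrite !addrA subrK [LHS]addrAC [_ - _ - _]addrAC [LHS]addrAC.
apply: frakr_add; first by have := half_frakF_star Fb; rewrite /half_frakF /= starK.
have := frakr_star (half_frakF_star Fa).
by rewrite starB starM !starK.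
Qed.

(** * Auxiliarity *)

Lemma auxiliary_le_r : auxiliary_on (half_frakF : set A) (@ll A) (@le_r A).
Proof.
apply: auxiliary_onI.
- exact: le_r_refl.
- by move=> a b Fa Fb /(half_frakF_sub Fa Fb)/half_frakF_frakr.
- move=> a c b Fa Fc Fb ac /(le_r_conjl a) cb; apply: ll_of_le => //.
  by move: cb; rewrite -ac.
- move=> a c b Fa Fc Fb /(le_r_conj (1 - b)) ac /llP cb; apply: ll_of_le0 => //.
  by move: ac; rewrite -(mulrA _ c) cb mulr0.
Qed.

Lemma auxiliary_le_c : auxiliary_on (half_frakF : set A) (@ll A) (@le_c A).
Proof.
apply: (auxiliary_on_sub auxiliary_le_r); first exact: le_c_le_r.
- by move=> a; exists 1%N => //; rewrite subrr mulr0; exact: le_r_refl.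
- by move=> a b Fa Fb /(half_frakF_sub Fa Fb) Fab; exists 1%N.
Qed.

Lemma ll_le_B a b : half_frakF a -> ll a b -> le_B a b.
Proof. by move=> /half_frakF_in_frakB Ba ab; exists a. Qed.

Lemma auxiliary_le_star :
  auxiliary_on (half_frakF : set A) (@ll A) (@le_star A).
Proof.
apply: auxiliary_onI.
- by move=> a; exact: le_r_refl.
- by move=> a b Fa _ /(ll_le_B Fa)/le_B_le_star.
- (* Here [a a^* = a c^* c a^*] is below [a b^* b a^*], hence below [a b a^*]. *)
  move=> a c b Fa Fc Fb ac /(le_r_conjl a) cb; apply: ll_of_le => //.
  have := le_r_trans cb (le_r_conjl a Fb).
  by rewrite mulrA -(ll_star Fc ac) -ac.
- move=> a c b Fa Fc Fb /(le_r_conj (1 - b)) ac /llP cb.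
  apply/llP/norm_le0_eq0; move: ac.
  by rewrite starM !mulrA -(mulrA _ c) cb mulr0.
Qed.

Lemma auxiliary_le_B : auxiliary_on (half_frakF : set A) (@ll A) (@le_B A).
Proof.
apply: (auxiliary_on_sub auxiliary_le_star); first exact: le_B_le_star.
- by move=> a; exists 1; [exact: frakB1 | rewrite mul1r].
- by move=> a b Fa _; exact: ll_le_B.
Qed.

Lemma auxiliary_le_F : auxiliary_on (half_frakF : set A) (@ll A) (@le_F A).
Proof.
apply: auxiliary_onI.
- by move=> a; exists 0; [exact: frakF0 | rewrite mulr0 addr0 subr0].
- move=> a b Fa Fb ab; exists b; first exact: half_frakF_frakF.
  by rewrite -ab addrC addKr.
- move=> a c b _ _ _ /llP ac [f _ /le_F_compl cb].
  by apply/llP; rewrite cb mulrA ac mul0r.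
- (* Write [y = 1 - b].  From [c y = c^* y = 0] and [1 - c = (1 - a) (1 - f)],
     [y^* y = y^* (1 - c) (1 - c)^* y] is below [y^* (1 - a) (1 - a)^* y], hence
     below [y^* (1 - a) y], so [y^* a y] is below [0]. *)
  move=> a c b Fa Fc Fb [f /frakF_frakB/frakB_star Ff /le_F_compl ac] /llP cb.
  apply: ll_of_le0 => //; set y := 1 - b in cb *.
  have cy : (1 - c)^* * y = y.
    by rewrite starB star1 mulrBl mul1r half_frakF_ann_star ?subr0.
  have yc : y^* * (1 - c) = y^* by rewrite -[in RHS]cy starM starK.
  have le_ca : le_r ((1 - c) * (1 - c)^*) ((1 - a) * (1 - a)^*).
    have := le_r_conjl (1 - a) Ff.
    by rewrite starK mulr1 !mulrA -ac -mulrA -starM -ac.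
  have le_a : le_r ((1 - a) * (1 - a)^*) (1 - a)^*.
    by have := half_frakF_star (half_frakF_compl Fa); rewrite /half_frakF /= starK.
  have := le_r_conj y (le_r_trans le_ca le_a).
  rewrite !mulrA yc -!mulrA cy => /frakr_star.
  rewrite /le_r sub0r starB !starM !starK.
  by rewrite (mulrBr y^* 1 a) mulr1 mulrBl addrC addKr mulrA.
Qed.

End Annihilation.

Theorem corollary3 (A : starRingType) (properA : proper_star A)
    (SigmaA : (Sigma : set A) `&` [set - s | s in (Sigma : set A)] = [set 0]) :
  auxiliary_on (half_frakF : set A) (@ll A) (@le_r A) /\
  auxiliary_on (half_frakF : set A) (@ll A) (@le_c A) /\
  auxiliary_on (half_frakF : set A) (@ll A) (@le_B A) /\
  auxiliary_on (half_frakF : set A) (@ll A) (@le_F A) /\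
  auxiliary_on (half_frakF : set A) (@ll A) (@le_star A).
Proof.
split; first exact: auxiliary_le_r.
split; first exact: auxiliary_le_c.
split; first exact: auxiliary_le_B.
split; first exact: auxiliary_le_F.
exact: auxiliary_le_star.
Qed.
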